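(* There is a universal constant $C>0$ such that the following holds. Let $K,D\ge1$ and $m\ge2$ be integers, let $\vec{u}\in\mathbb{R}^K$ with $\|\vec{u}\|_2=1/\sqrt m$, let $\mathcal{D}$ and $\mathcal{A}$ be the distribution and linear-classifier learning algorithm described in the context, and let the loss be $\mathcal{L}=\mathcal{L}^{(\gamma)}$ with $\gamma\in[0,1]$. For any $\epsilon,\delta>0$ with $\delta<1/12$, if $D\ge C\max\left(m\ln\frac{3}{\delta},\,m\ln\frac1\epsilon\right)$, then $$e^{-3/2}(1-\epsilon)-(1-e^{-3/2})\,\epsilon\;\le\;\epsilon_{\text{pb-det-A}}(m,\delta).$$
   Context: Distribution $\mathcal{D}$: inputs are $\vec{x}=(\vec{x}_1,\vec{x}_2)$ with $\vec{x}_1\in\mathbb{R}^K$, $\vec{x}_2\in\mathbb{R}^D$. The label $y$ is uniform on $\{-1,+1\}$; given $y$, $\vec{x}_1=2y\vec{u}$, and $\vec{x}_2$ is drawn independently from $\mathcal{N}(0,\frac{32}{D}I)$. Algorithm $\mathcal{A}$: a linear classifier with weights $\vec{w}=(\vec{w}_1,\vec{w}_2)$ and output $h(\vec{x})=\vec{w}_1\cdot\vec{x}_1+\vec{w}_2\cdot\vec{x}_2$, initialized at the origin. Given $S=\{(\vec{x}^{(i)},y^{(i)})\}_{i=1}^m$, it takes a gradient step of learning rate $1$ to maximize $y\cdot h(\vec{x})$ for each $(\vec{x},y)\in S$; hence the learned hypothesis $h_S$ has weights $\vec{w}_1=2m\vec{u}$ and $\vec{w}_2=\sum_{i} y^{(i)}\vec{x}_2^{(i)}$.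 The hypothesis class $\mathcal{H}$ is the class of such linear classifiers. Loss: for $\gamma\ge0$, $y'\in\mathbb{R}$, $y\in\{-1,+1\}$, $\mathcal{L}^{(\gamma)}(y',y)=1$ if $yy'\le 0$; $=1-\frac{yy'}{\gamma}$ if $yy'\in(0,\gamma)$; $=0$ if $yy'\ge\gamma$ and $yy'>0$. $\mathcal{L}_{\mathcal{D}}(h):=\mathbb{E}_{(\vec{x},y)\sim\mathcal{D}}[\mathcal{L}(h(\vec{x}),y)]$ and $\hat{\mathcal{L}}_S(h):=\frac1m\sum_{(\vec{x},y)\in S}\mathcal{L}(h(\vec{x}),y)$. PAC-Bayes quantities: for distributions $P$ (prior) and $Q$ over hypotheses, $\epsilon_{\text{pb}}(P,Q,m,\delta):=\frac{KL(Q\|P)+\ln\frac{2m}{\delta}}{m-1}$. For $a,b\in[0,1]$, $KL(a\|b)=a\ln\frac ab+(1-a)\ln\frac{1-a}{1-b}$. For a fixed prior $P$, the PAC-Bayesian inequality for a dataset $S$ is: for all distributions $Q$ over hypotheses, $KL\big(\mathbb{E}_{\tilde h\sim Q}[\hat{\mathcal{L}}_S(\tilde h)]\,\big\|\,\mathbb{E}_{\tilde h\sim Q}[\mathcal{L}_{\mathcal{D}}(\tilde h)]\big)\le\epsilon_{\text{pb}}(P,Q,m,\delta)$; it implies $\mathbb{E}_{\tilde h\sim Q}[\mathcal{L}_{\mathcal{D}}(\tilde h)]-\mathbb{E}_{\tilde h\sim Q}[\hat{\mathcal{L}}_S(\tilde h)]\le\sqrt{2\epsilon_{\text{pb}}}+2\epsilon_{\text{pb}}$.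 Let $\Delta(h,Q,\mathcal{D})=|\mathcal{L}_{\mathcal{D}}(h)-\mathbb{E}_{\tilde h\sim Q}[\mathcal{L}_{\mathcal{D}}(\tilde h)]|$ and $\Delta(h,Q,S)=|\hat{\mathcal{L}}_S(h)-\mathbb{E}_{\tilde h\sim Q}[\hat{\mathcal{L}}_S(\tilde h)]|$. Definition: $\epsilon_{\text{pb-det-A}}(m,\delta)$ (with respect to $\mathcal{L}$) is the smallest value (infimum) such that: there exist a set $\mathcal{S}_\delta$ of datasets of size $m$ with $\Pr_{S\sim\mathcal{D}^m}[S\notin\mathcal{S}_\delta]\le\delta$, and, with $\mathcal{H}_\delta=\bigcup_{S\in\mathcal{S}_\delta}\{h_S\}$, a prior $P$ and for each $h\in\mathcal{H}_\delta$ a distribution $Q_h$, such that the PAC-Bayesian inequality with prior $P$ holds for every $S\in\mathcal{S}_\delta$ and $$\sup_{S\in\mathcal{S}_\delta}\sup_{h\in\mathcal{H}_\delta}\ \sqrt{2\epsilon_{\text{pb}}(P,Q_h,m,\delta)}+2\epsilon_{\text{pb}}(P,Q_h,m,\delta)+\Delta(h,Q_h,\mathcal{D})+\Delta(h,Q_h,S)<\epsilon_{\text{pb-det-A}}(m,\delta)$$ (as a result of which also $\sup_{S\in\mathcal{S}_\delta}\sup_{h\in\mathcal{H}_\delta}\mathcal{L}_{\mathcal{D}}(h)-\hat{\mathcal{L}}_S(h)<\epsilon_{\text{pb-det-A}}(m,\delta)$). *)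

(* Defs.v *)
From HB Require Import structures.
From mathcomp Require Import all_boot all_order all_algebra.
From mathcomp Require Import all_classical all_reals all_analysis.
From mathcomp Require Import ring.

Set Implicit Arguments.
Unset Strict Implicit.
Unset Printing Implicit Defensive.

Import Order.TTheory GRing.Theory Num.Theory.
Import numFieldNormedType.Exports.

Local Open Scope classical_set_scope.
Local Open Scope ring_scope.

(* The law of n independent draws from P. *)
Section iid.
Context {d : measure_display} {T : measurableType d} {R : realType}.

Definition tuple_cons n (x : T * n.-tuple T) : n.+1.-tuple T :=
  [the n.+1.-tuple T of x.1 :: x.2].

Let measurable_tuple_cons n : measurable_fun setT (@tuple_cons n).
Proof. by apply: measurable_cons. Qed.

HB.instance Definition _ n :=
  isMeasurableFun.Build _ _ _ _ (@tuple_cons n) (@measurable_tuple_cons n).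

Variable P : probability T R.

Fixpoint iid n : probability (n.-tuple T) R :=
  match n return probability (n.-tuple T) R with
  | 0 => \d_([tuple] : 0.-tuple T)
  | n'.+1 => distribution (P \x iid n')%E (@tuple_cons n')
  end.

Lemma iid_box n (A : 'I_n -> set T) : (forall i, measurable (A i)) ->
  iid n [set t | forall i, A i (tnth t i)] = (\prod_(i < n) P (A i))%E.
Proof.
elim: n A => [|n IH] A mA.
  rewrite big_ord0 /= diracE; rewrite mem_set//=; by case.
rewrite big_ord_recl -IH//= /distribution /pushforward.
rewrite -product_measure1E//; last first.
  have -> : [set t : n.-tuple T | forall i, A (lift ord0 i) (tnth t i)] =
      \bigcap_(i in [set: 'I_n]) ((@tnth n T)^~ i @^-1` A (lift ord0 i)).
    by apply/seteqP; split => t /= h i; [move=> _|]; exact: (h i).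
  apply: fin_bigcap_measurable; first exact: finite_finset.
  move=> i _; rewrite -[X in measurable X]setTI.
  exact: (measurable_tnth i measurableT (mA _)).
congr ((_ \x _)%E _); apply/seteqP; split => -[x t] /=.
- move=> h; split; first exact: (h ord0).
  by move=> i; have := h (lift ord0 i); rewrite /tuple_cons tnthS.
- move=> [h0 h] i; case: (unliftP ord0 i) => [j|] ->.
    by rewrite /tuple_cons tnthS; exact: h.
  exact: h0.
Qed.

End iid.

(* The product sigma-algebra on tuples is the Borel sigma-algebra of R^n. *)
Notation rvec R n := (n.-tuple (measurableTypeR R)).

Section vectors.
Context {R : realType}.

Definition dotp n (v w : rvec R n) : R := \sum_(i < n) tnth v i * tnth w i.

Definition norm2 n (v : rvec R n) : R := Num.sqrt (\sum_(i < n) tnth v i ^+ 2).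

Definition scalev n (a : R) (v : rvec R n) : rvec R n :=
  [tuple a * tnth v i | i < n].

Definition set_coord n (v : rvec R n) (i : 'I_n) (t : R) : rvec R n :=
  [tuple (if j == i then t else tnth v j) | j < n].

Definition partial n (F : rvec R n -> R) (i : 'I_n) (v : rvec R n) : R :=
  derive1 (fun t : R => F (set_coord v i t)) (tnth v i).

End vectors.

Notation input R K D := (rvec R K * rvec R D)%type.

(* A linear classifier is represented by its weights (w_1, w_2). *)
Notation hypothesis R K D := (rvec R K * rvec R D)%type.

(* Labels in {-1, +1} are encoded as booleans; see label below. *)
Notation sample R K D := (input R K D * bool)%type.

Section learning_problem.
Context {R : realType} {K D : nat}.
Local Notation input := (input R K D).
Local Notation hypothesis := (hypothesis R K D).
Local Notation sample := (sample R K D).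

Definition label (b : bool) : R := if b then 1 else -1.

Definition output (w : hypothesis) (x : input) : R :=
  dotp w.1 x.1 + dotp w.2 x.2.

Definition margin (w : hypothesis) (z : sample) : R :=
  label z.2 * output w z.1.

(* N(0, (32 / D) I); normal_prob takes a standard deviation. *)
Definition noise : probability (rvec R D) R :=
  iid (normal_prob 0 (Num.sqrt (32 / D%:R))) D.

Section data.
Variable u : rvec R K.

Definition make_sample (yx : bool * rvec R D) : sample :=
  ((scalev (2 * label yx.1) u, yx.2), yx.1).

Let measurable_make_sample : measurable_fun setT make_sample.
Proof.
apply/measurable_fun_pairP; split; last exact: measurable_fst.
apply/measurable_fun_pairP; split; last exact: measurable_snd.
exact: (measurableT_comp (f := fun b => scalev (2 * label b) u)).
Qed.

HB.instance Definition _ :=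
  isMeasurableFun.Build _ _ _ _ make_sample measurable_make_sample.

Definition data : probability sample R :=
  distribution (bernoulli_prob (2^-1 : R) \x noise)%E make_sample.

End data.

(* One step of gradient ascent on the function w |-> y h_w(x). *)
Definition gradient_step (eta : R) (w : hypothesis) (z : sample) : hypothesis :=
  ([tuple tnth w.1 i + eta * partial (fun v => margin (v, w.2) z) i w.1 | i < K],
   [tuple tnth w.2 i + eta * partial (fun v => margin (w.1, v) z) i w.2 | i < D]).

Definition origin : hypothesis := ([tuple 0 | i < K], [tuple 0 | i < D]).

Definition learn m (S : m.-tuple sample) : hypothesis :=
  foldl (gradient_step 1) origin S.

Lemma dotp_set_coord n (v w : rvec R n) i t :
  dotp (set_coord v i t) w =
    t * tnth w i + \sum_(j < n | j != i) tnth v j * tnth w j.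
Proof.
rewrite /dotp (bigD1 i)//= tnth_mktuple eqxx; congr (_ + _).
by apply: eq_bigr => j /negbTE ji; rewrite tnth_mktuple ji.
Qed.

Let partial_affine n (F : rvec R n -> R) i v (a b : R) :
  (forall t, F (set_coord v i t) = a * t + b) -> partial F i v = a.
Proof.
move=> FE; rewrite /partial.
have -> : (fun t : R => F (set_coord v i t)) = (a \*: @id R) + cst b.
  exact/funext.
rewrite derive1E.
have dF := is_deriveD (is_deriveZ a (is_derive_id (tnth v i) (1 : R)))
  (is_derive_cst b (tnth v i) (1 : R)).
by rewrite (@derive_val _ _ _ _ _ _ _ dF) addr0 /GRing.scale /= mulr1.
Qed.

Lemma gradient_stepE eta w z : gradient_step eta w z =
  ([tuple tnth w.1 i + eta * (label z.2 * tnth z.1.1 i) | i < K],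
   [tuple tnth w.2 i + eta * (label z.2 * tnth z.1.2 i) | i < D]).
Proof.
congr pair; apply/eq_from_tnth => i; rewrite !tnth_mktuple; congr (_ + _ * _).
- apply: (partial_affine (b := label z.2 *
    (\sum_(j < K | j != i) tnth w.1 j * tnth z.1.1 j + dotp w.2 z.1.2))) => t.
  rewrite /margin /output /= dotp_set_coord; ring.
- apply: (partial_affine (b := label z.2 *
    (\sum_(j < D | j != i) tnth w.2 j * tnth z.1.2 j + dotp w.1 z.1.1))) => t.
  rewrite /margin /output /= dotp_set_coord; ring.
Qed.

Lemma learnE m (S : m.-tuple sample) : learn S =
  ([tuple \sum_(z <- S) label z.2 * tnth z.1.1 i | i < K],
   [tuple \sum_(z <- S) label z.2 * tnth z.1.2 i | i < D]).
Proof.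
suff foldE (s : seq sample) w : foldl (gradient_step 1) w s =
    ([tuple tnth w.1 i + \sum_(z <- s) label z.2 * tnth z.1.1 i | i < K],
     [tuple tnth w.2 i + \sum_(z <- s) label z.2 * tnth z.1.2 i | i < D]).
  rewrite /learn foldE; congr pair; apply/eq_from_tnth => i;
  by rewrite !tnth_mktuple add0r.
elim: s w => [|z s IH] w /=.
  rewrite [LHS]surjective_pairing; congr pair; apply/eq_from_tnth => i;
  by rewrite tnth_mktuple big_nil addr0.
rewrite IH gradient_stepE; congr pair; apply/eq_from_tnth => i /=;
by rewrite !tnth_mktuple big_cons mul1r addrA.
Qed.

(* The learned weights on every data set in the support of the distribution. *)
Lemma learn_make_sample (u : rvec R K) m (s : m.-tuple (bool * rvec R D)) :
  learn [tuple of map (make_sample u) s] =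
  (scalev (2 * m%:R) u,
   [tuple \sum_(yx <- s) label yx.1 * tnth yx.2 i | i < D]).
Proof.
rewrite learnE; congr pair; apply/eq_from_tnth => i; rewrite !tnth_mktuple/=;
  rewrite big_map//.
transitivity (\sum_(yx <- s) 2 * tnth u i).
  apply: eq_bigr => -[y x] _ /=; rewrite tnth_mktuple /label.
  case: y; ring.
rewrite big_const_seq count_predT size_tuple iter_addr addr0.
by rewrite -[LHS]mulr_natr mulrAC.
Qed.

End learning_problem.

Definition ramp_loss {R : realType} (gamma y' y : R) : R :=
  if y * y' <= 0 then 1
  else if y * y' < gamma then 1 - y * y' / gamma
  else 0.

Section divergences.
Context {R : realType}.
Local Open Scope ereal_scope.
Local Open Scope charge_scope.

(* The conventions are 0 ln (0 / b) = 0, and a ln (a / 0) = +oo for a > 0. *)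
Definition kl_term (a b : R) : \bar R :=
  if a == 0%R then 0
  else if b == 0%R then +oo
  else (a * ln (a / b))%:E.

Definition kl_bernoulli (a b : R) : \bar R :=
  kl_term a b + kl_term (1 - a) (1 - b).

Definition KL {d} {T : measurableType d} (Q P : probability T R) : \bar R :=
  if `[< Q `<< P >]
  then \int[Q]_x lne (('d (charge_of_finite_measure Q) '/d P) x)
  else +oo.

End divergences.

Section pac_bayes.
Context {R : realType} {dH dZ : measure_display}.
Context {H : measurableType dH} {Z : measurableType dZ}.
(* loss h z is the loss of the hypothesis h on the labelled example z. *)
Variables (loss : H -> Z -> R) (mu : probability Z R).
Variables (m : nat) (A : m.-tuple Z -> H) (delta : R).

Definition risk (h : H) : R := \int[mu]_z loss h z.

Definition emp_risk (S : m.-tuple Z) (h : H) : R :=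
  m%:R^-1 * \sum_(i < m) loss h (tnth S i).

Definition eps_pb (P Q : probability H R) : \bar R :=
  ((KL Q P + (ln (2 * m%:R / delta))%:E) * ((m%:R - 1)^-1)%:E)%E.

Definition pac_bayes_ineq (P : probability H R) (S : m.-tuple Z) : Prop :=
  forall Q : probability H R,
    (kl_bernoulli (\int[Q]_h emp_risk S h) (\int[Q]_h risk h)
       <= eps_pb P Q)%E.

Definition gap_risk (h : H) (Q : probability H R) : R :=
  `|risk h - \int[Q]_h' risk h'|.

Definition gap_emp (h : H) (Q : probability H R) (S : m.-tuple Z) : R :=
  `|emp_risk S h - \int[Q]_h' emp_risk S h'|.

Definition derandomized_bound (P Q : probability H R) (h : H)
    (S : m.-tuple Z) : \bar R :=
  ((2%:E * eps_pb P Q) `^ 2^-1 + 2%:E * eps_pb P Q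
     + (gap_risk h Q)%:E + (gap_emp h Q S)%:E)%E.

Definition admissible (v : \bar R) : Prop :=
  exists Sd : set (m.-tuple Z),
  [/\ measurable Sd, (iid mu m (~` Sd) <= delta%:E)%E &
  exists (P : probability H R) (Q : H -> probability H R),
    (forall S, Sd S -> pac_bayes_ineq P S) /\
    (ereal_sup [set derandomized_bound P (Q h) h S | S in Sd & h in A @` Sd]
       < v)%E].

Definition eps_pb_det_A : \bar R := ereal_inf [set v | admissible v].

End pac_bayes.

(* Main.v *)
Require Import Defs.
From mathcomp Require Import all_boot all_order all_algebra.
From mathcomp Require Import all_classical all_reals all_analysis.
From mathcomp Require Import measurable_realfun ring lra.

Set Implicit Arguments.
Unset Strict Implicit.
Unset Printing Implicit Defensive.

Import Order.TTheory GRing.Theory Num.Theory.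

Local Open Scope classical_set_scope.
Local Open Scope ring_scope.

(* Negating the noise of every example maps a data set S to an equally likely
   data set S'. The learned h_S correlates with the noise of S, so it has nearly
   full empirical error on S' although its risk is small. Since delta < 1/12,
   with positive probability S and S' are both in S_delta and
   emp_risk S' h_S - risk h_S >= 1/2. The PAC-Bayesian inequality for S' bounds
   E_Q emp_risk - E_Q risk by sqrt (2 eps_pb), and the two Delta terms bridge from
   E_Q to h_S; hence the bound exceeds 1/2 >= exp (-3/2). Second moments and one
   Laplace transform of the Gaussian noise are enough, because only an event of
   probability above 2 delta is needed. *)

(** * Integrals of nonnegative functions *)

Section nonneg_integrals.
Local Open Scope ereal_scope.

(** The supremum in the definition lets the data set and the hypothesis vary independently, which is
    why h_S may be tested on S'. The signal part of every margin is 4, because |u|^2 = 1/m. Example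
    i also meets itself inside w_2, and once its noise is negated this self-interaction becomes
    -|x_i|^2, whose mean -32 outweighs the signal. What remains is the interaction of x_i with the
    other examples, and of fresh noise with w_2. Both have second moments of order m / D, so they
    are negligible once D is a large multiple of m.

    The obstacle is measurability: risks as functions of h, hence the integrands under Q, are not
    shown to be measurable. Averages over Q are therefore used only through bounds that hold for
    arbitrary integrands with values in [0, 1]. On the side of the data, all errors are collected in
    one explicit measurable function [deficit] >= 0, such that the gap is at least 1 - [deficit].
    Its integral is at most 1/4, so a Markov argument combined with the two events of probability at
    most delta yields the data set. *)

(** The integral of a nonnegative function is a supremum over the simple functions below it, hence
    monotone for arbitrary functions, measurable or not. *)
Lemma le_nnintegral {d} {T : measurableType d} {R : realType}
    (mu : {measure set T -> \bar R}) (f g : T -> \bar R) :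
  (forall x, 0 <= f x) -> (forall x, f x <= g x) ->
  \int[mu]_x f x <= \int[mu]_x g x.
Proof.
move=> f0 fg; have g0 x : 0 <= g x := le_trans (f0 x) (fg x).
rewrite !ge0_integralTE//; apply: ge_ereal_sup => _ [h hf <-].
by apply: ereal_sup_ubound; exists h => // x; exact: le_trans (hf x) (fg x).
Qed.

Lemma nnintegral_le_cst {d} {T : measurableType d} {R : realType}
    (P : probability T R) (f : T -> \bar R) (a : R) :
  (forall x, 0 <= f x) -> (forall x, f x <= a%:E) -> \int[P]_x f x <= a%:E.
Proof.
move=> f0 fa; apply: (le_trans (le_nnintegral P f0 fa)).
by rewrite integral_cst// [X in (_ * X)%E](@probability_setT _ _ _ P) mule1.
Qed.

Lemma Rintegral_itv01 {d} {T : measurableType d} {R : realType}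
    (P : probability T R) (f : T -> R) :
  (forall x, 0 <= f x <= 1)%R -> (0 <= \int[P]_x f x <= 1)%R.
Proof.
move=> f01; have f0 x : (0 <= f x)%R by case/andP: (f01 x).
rewrite Rintegral_ge0//= -lee_fin /Rintegral.
have Ile : \int[P]_x (f x)%:E <= 1%:E.
  by apply: nnintegral_le_cst => x; rewrite lee_fin; case/andP: (f01 x).
rewrite fineK// ge0_fin_numE ?(le_lt_trans Ile) ?ltry//.
by apply: integral_ge0 => x _; rewrite lee_fin.
Qed.

Lemma Rintegral_le {d} {T : measurableType d} {R : realType}
    (mu : {measure set T -> \bar R}) (f : T -> R) (a : R) :
  (forall x, 0 <= f x)%R -> \int[mu]_x (f x)%:E <= a%:E ->
  (\int[mu]_x f x <= a)%R.
Proof.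
move=> f0 Ile; rewrite -lee_fin /Rintegral fineK//.
rewrite ge0_fin_numE ?(le_lt_trans Ile) ?ltry//.
by apply: integral_ge0 => x _; rewrite lee_fin.
Qed.

End nonneg_integrals.

(** * Image laws and independent draws *)

Section image_laws.
Context {R : realType}.
Local Open Scope ereal_scope.

(** Stated by integrals of nonnegative functions for a plain function [phi], so that it passes
    through products and tuples by Tonelli. *)
Definition image_law {d d'} {T : measurableType d} {T' : measurableType d'}
    (P : probability T R) (phi : T -> T') (P' : probability T' R) :=
  forall f : T' -> \bar R, measurable_fun setT f -> (forall x, 0 <= f x) ->
  \int[P']_x f x = \int[P]_x f (phi x).

Lemma image_law_distribution {d d'} {T : measurableType d}
    {T' : measurableType d'} (P : probability T R) (phi : {mfun T >-> T'}) :
  image_law P phi (distribution P phi).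
Proof. by move=> f mf f0; rewrite ge0_integral_distribution. Qed.

Lemma image_law_prod {d1 d2 d1' d2'} {T1 : measurableType d1}
    {T2 : measurableType d2} {T1' : measurableType d1'}
    {T2' : measurableType d2'} (P1 : probability T1 R) (P2 : probability T2 R)
    (P1' : probability T1' R) (P2' : probability T2' R)
    (phi1 : T1 -> T1') (phi2 : T2 -> T2') :
  measurable_fun setT phi1 -> measurable_fun setT phi2 ->
  image_law P1 phi1 P1' -> image_law P2 phi2 P2' ->
  image_law (P1 \x P2) (fun z => (phi1 z.1, phi2 z.2)) (P1' \x P2').
Proof.
move=> m1 m2 I1 I2 f mf f0.
rewrite fubini_tonelli1// fubini_tonelli1//; last first.
  apply: (measurableT_comp mf); apply/measurable_fun_pairP; split => /=.
    exact: (measurableT_comp m1).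
  exact: (measurableT_comp m2).
rewrite I1; last 2 first.
- exact: measurable_fun_fubini_tonelli_F.
- by move=> x; apply: integral_ge0.
apply: eq_integral => x _; rewrite /fubini_F I2//.
exact: measurableT_comp.
Qed.

Section iid.
Context {d} {T : measurableType d}.
Variable P : probability T R.

Lemma integral_iid_cons n (f : n.+1.-tuple T -> \bar R) :
  measurable_fun setT f -> (forall t, 0 <= f t) ->
  \int[iid P n.+1]_t f t = \int[P]_x \int[iid P n]_t f [tuple of x :: t].
Proof.
move=> mf f0; rewrite /= ge0_integral_distribution// fubini_tonelli1//.
- exact: measurableT_comp.
- by move=> z /=.
Qed.

Lemma measurable_integral_cons n (f : n.+1.-tuple T -> \bar R) :
  measurable_fun setT f -> (forall t, 0 <= f t) ->
  measurable_fun setT (fun x => \int[iid P n]_t f [tuple of x :: t]).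
Proof.
move=> mf f0.
apply: (@measurable_fun_fubini_tonelli_F _ _ _ _ _ (iid P n)
  (fun z => f (tuple_cons z))) => //.
exact: measurableT_comp.
Qed.

Lemma integral_iid_cons_le n (f : n.+1.-tuple T -> \bar R) (g : T -> \bar R) B :
  measurable_fun setT f -> (forall t, 0 <= f t) ->
  (forall x, \int[iid P n]_t f [tuple of x :: t] <= g x) ->
  \int[P]_x g x <= B -> \int[iid P n.+1]_t f t <= B.
Proof.
move=> mf f0 fg gB; rewrite integral_iid_cons//; apply: le_trans gB.
by apply: le_nnintegral => // x; apply: integral_ge0.
Qed.

End iid.

Lemma measurable_map_tuple {d d'} {T : measurableType d}
    {T' : measurableType d'} n (phi : T -> T') :
  measurable_fun setT phi ->
  measurable_fun setT (fun t : n.-tuple T => [tuple of map phi t]).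
Proof.
move=> mphi; apply/measurable_fun_tnthP => i.
rewrite (_ : _ \o _ = phi \o (fun t : n.-tuple T => tnth t i)).
  by apply: measurableT_comp => //; exact: measurable_tnth.
by apply/funext => t /=; rewrite tnth_map.
Qed.

Lemma image_law_iid {d d'} {T : measurableType d} {T' : measurableType d'}
    (P : probability T R) (phi : T -> T') (P' : probability T' R) n :
  measurable_fun setT phi -> image_law P phi P' ->
  image_law (iid P n) (fun t => [tuple of map phi t]) (iid P' n).
Proof.
move=> mphi I; elim: n => [|n IH] f mf f0.
  rewrite /= !integral_dirac//; last first.
    exact: (measurableT_comp mf (measurable_map_tuple mphi)).
  by rewrite !diracT; congr (_ * f _); apply: val_inj.
rewrite !integral_iid_cons//; last first.
  exact: (measurableT_comp mf (measurable_map_tuple mphi)).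
rewrite I; last 2 first.
- exact: measurable_integral_cons.
- by move=> x; apply: integral_ge0.
apply: eq_integral => x _; rewrite IH//.
  by apply: eq_integral => t _; congr f; exact: val_inj.
by apply: (measurableT_comp mf); exact: measurable_cons.
Qed.

End image_laws.

(** * Gaussian moments *)

Section normal_law.
Context {R : realType}.
Local Open Scope ereal_scope.
Local Notation mu := (@lebesgue_measure R).

(** The Radon-Nikodym derivative of the normal law and [normal_pdf] have the same integral over
    every measurable set, so they agree almost everywhere. *)
Lemma ge0_integral_normal_prob (a s : R) (f : measurableTypeR R -> \bar R) :
  measurable_fun setT f -> (forall x, 0 <= f x) ->
  \int[normal_prob a s]_x f x = \int[mu]_x (f x * (normal_pdf a s x)%:E).
Proof.
move=> mf f0; pose nu : {finite_measure set _ -> \bar R} := normal_prob a s.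
have dom : nu `<< mu := normal_prob_dominates a s.
rewrite -(Radon_Nikodym_SigmaFinite.change_of_variables dom f0 measurableT mf).
have mpdf : measurable_fun setT (fun x : R => (normal_pdf a s x)%:E).
  by apply/measurable_EFinP; exact: measurable_normal_pdf.
have iRN := Radon_Nikodym_SigmaFinite.f_integrable dom.
apply: ge0_ae_eq_integral => //.
- exact: emeasurable_funM (measurable_int _ iRN).
- exact: emeasurable_funM.
- by move=> x _; rewrite mule_ge0// Radon_Nikodym_SigmaFinite.f_ge0.
- by move=> x _; rewrite mule_ge0// lee_fin normal_pdf_ge0.
apply: ae_eqe_mul2l; apply: integral_ae_eq => //.
by move=> E _ mE; rewrite -Radon_Nikodym_SigmaFinite.f_integral.
Qed.

(** Lebesgue measure is invariant under reflection and the centred density is even. *)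
Lemma image_law_normalN (s : R) : s != 0%R ->
  image_law (normal_prob 0 s) (-%R : measurableTypeR R -> measurableTypeR R)
    (normal_prob 0 s).
Proof.
move=> s0 f mf f0.
have mfN : measurable_fun setT (fun x : measurableTypeR R => f (- x)%R).
  by apply: (measurableT_comp mf); exact: oppr_measurable.
have mpdf : measurable_fun setT (fun x : R => (normal_pdf 0 s x)%:E).
  by apply/measurable_EFinP; exact: measurable_normal_pdf.
rewrite !ge0_integral_normal_prob//.
pose g (x : measurableTypeR R) := f x * (normal_pdf 0 s x)%:E.
have mg : measurable_fun setT g by exact: emeasurable_funM.
have g0 x : 0 <= g x by rewrite mule_ge0// lee_fin normal_pdf_ge0.
transitivity (\int[pushforward mu
    (-%R : measurableTypeR R -> measurableTypeR R)]_x g x).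
  apply: eq_measure_integral => A mA _.
  exact: (esym (lebesgue_measureN mA)).
have mN : measurable_fun setT (-%R : measurableTypeR R -> measurableTypeR R).
  exact: oppr_measurable.
have gE := @ge0_integral_pushforward _ _ _ _ R _ mN mu setT g measurableT mg
  (fun x _ => g0 x).
rewrite [LHS]gE.
apply: eq_integral => x _; rewrite /g /= !normal_pdfE// /normal_fun !subr0.
by rewrite sqrrN.
Qed.

(** The exponential turns the density of standard deviation [s] into [t / s] times the density of
    standard deviation [t]. It serves twice: [t = 2 * s] gives a second moment, [t = s / 2] a
    Laplace transform. *)
Lemma normal_exp_sqr (s t : R) : (0 < s)%R -> (0 < t)%R ->
  \int[normal_prob 0 s]_x (expR ((s ^- 2 - t ^- 2) / 2 * x ^+ 2))%:E
    = (t / s)%:E.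
Proof.
move=> s0 t0; rewrite ge0_integral_normal_prob//; first last.
- apply/measurable_EFinP; apply: measurableT_comp => //.
  by apply: measurable_funM => //; exact: measurable_funX.
transitivity (\int[mu]_x ((t / s)%:E * (normal_pdf 0 t x)%:E)).
  apply: eq_integral => x _; rewrite -!EFinM; congr (_%:E).
  rewrite !normal_pdfE ?gt_eqF// /normal_fun !subr0.
  have peakE (r : R) : (0 < r)%R ->
      normal_peak r = (r^-1 * (Num.sqrt (pi *+ 2))^-1)%R.
    move=> r0; rewrite /normal_peak -mulrnAr sqrtrM ?sqr_ge0//.
    by rewrite sqrtr_sqr gtr0_norm// invfM.
  rewrite !peakE// mulrCA -expRD [RHS]mulrA [(t / s * _)%R]mulrA.
  rewrite [(t / s / t)%R]mulrAC divff ?gt_eqF// mul1r.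
  congr (_ * expR _)%R; field.
  by rewrite !gt_eqF.
rewrite ge0_integralZl ?integral_normal_pdf ?mule1//.
- by apply/measurable_EFinP; exact: measurable_normal_pdf.
- by move=> x _; rewrite lee_fin normal_pdf_ge0.
- by rewrite lee_fin divr_ge0 ?ltW.
Qed.

(** With [t = 2 * s] the exponent is y = 3/8 (x / s)^2, so x^2 = 8/3 s^2 y <= 3 s^2 exp y, and exp y
    has integral 2. The constant 6 is crude, the true one being 1; it is the source of 192 = 6 * 32
    below. *)
Lemma normal_sqr_le (s : R) : (0 < s)%R ->
  \int[normal_prob 0 s]_x (x ^+ 2)%:E <= (6 * s ^+ 2)%:E.
Proof.
move=> s0; pose t := (2 * s)%R.
have t0 : (0 < t)%R by rewrite mulr_gt0.
pose e (x : measurableTypeR R) := expR ((s ^- 2 - t ^- 2) / 2 * x ^+ 2).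
have le_e (x : R) : (x ^+ 2 <= 3 * s ^+ 2 * e x)%R.
  pose y := ((s ^- 2 - t ^- 2) / 2 * x ^+ 2)%R.
  have y0 : (0 <= y)%R.
    have -> : (y = 3 / 8 * (x / s) ^+ 2)%R.
      by rewrite /y /t; field; rewrite gt_eqF.
    by rewrite mulr_ge0 ?sqr_ge0//.
  have -> : (x ^+ 2 = 8 / 3 * s ^+ 2 * y)%R.
    by rewrite /y /t; field; rewrite gt_eqF.
  have := expR_ge1Dx y; rewrite -/y -/(e x) => ey.
  have s2 : (0 <= s ^+ 2)%R by exact: sqr_ge0.
  have -> : (8 / 3 * s ^+ 2 * y = s ^+ 2 * (8 / 3 * y))%R by ring.
  have -> : (3 * s ^+ 2 * e x = s ^+ 2 * (3 * e x))%R by ring.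
  by rewrite ler_wpM2l//; lra.
apply: (@le_trans _ _ (\int[normal_prob 0 s]_x ((3 * s ^+ 2)%:E * (e x)%:E))).
  by apply: le_nnintegral => x; rewrite lee_fin ?sqr_ge0.
rewrite ge0_integralZl//.
- rewrite normal_exp_sqr// -EFinM lee_fin /t mulfK ?gt_eqF//.
  by lra.
- apply/measurable_EFinP; apply: measurableT_comp => //.
  by apply: measurable_funM => //; exact: measurable_funX.
- by move=> x _; rewrite lee_fin expR_ge0.
- by rewrite lee_fin mulr_ge0 ?sqr_ge0//.
Qed.

(** Adding the integrand to its reflection cancels the cross term 2 a b x and leaves only
    nonnegative terms, so no signed integral arises. *)
Lemma normal_affine_sqr_le (s a b : R) : (0 < s)%R ->
  \int[normal_prob 0 s]_x ((a + b * x) ^+ 2)%:E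
    <= (a ^+ 2 + 6 * s ^+ 2 * b ^+ 2)%:E.
Proof.
move=> s0; pose f (c : R) (x : measurableTypeR R) := ((a + c * x) ^+ 2)%R.
have mf c : measurable_fun setT (fun x : measurableTypeR R => (f c x)%:E).
  apply/measurable_EFinP; apply: measurable_funX.
  by apply: measurable_funD => //; exact: measurable_funM.
have f0 c x : 0 <= (f c x)%:E by rewrite lee_fin sqr_ge0.
have fN : \int[normal_prob 0 s]_x (f b x)%:E =
    \int[normal_prob 0 s]_x (f (- b)%R x)%:E.
  rewrite (image_law_normalN _ (mf b))// ?gt_eqF//.
  by apply: eq_integral => x _; rewrite /f mulrN mulNr.
have x2 : measurable_fun setT (fun x : measurableTypeR R => (x ^+ 2)%:E).
  by apply/measurable_EFinP; exact: measurable_funX.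
have ff : \int[normal_prob 0 s]_x (f b x)%:E +
    \int[normal_prob 0 s]_x (f b x)%:E <=
    (2 * (a ^+ 2 + 6 * s ^+ 2 * b ^+ 2))%:E.
  rewrite {2}fN -ge0_integralD//.
  rewrite (eq_integral (fun x : measurableTypeR R =>
    (2 * a ^+ 2)%:E + (2 * b ^+ 2)%:E * (x ^+ 2)%:E)).
    rewrite ge0_integralD//; last 3 first.
    - by move=> x _; rewrite lee_fin mulr_ge0 ?sqr_ge0//.
    - move=> x _; apply: mule_ge0; rewrite lee_fin ?sqr_ge0//.
      by rewrite mulr_ge0 ?sqr_ge0.
    - exact: emeasurable_funM.
    rewrite integral_cst//.
    rewrite [X in (_ * X)%E](@probability_setT _ _ _ (normal_prob 0 s)) mule1.
    rewrite ge0_integralZl//; last 2 first.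
    - by move=> x _; rewrite lee_fin sqr_ge0.
    - by rewrite lee_fin mulr_ge0 ?sqr_ge0//.
    rewrite mulrDr EFinD leeD2l//.
    apply: (@le_trans _ _ ((2 * b ^+ 2)%:E * (6 * s ^+ 2)%:E)).
      by rewrite lee_wpmul2l ?normal_sqr_le// lee_fin mulr_ge0 ?sqr_ge0//.
    by rewrite -EFinM lee_fin; lra.
  by move=> x _; rewrite /f -EFinM -!EFinD; congr (_%:E); ring.
have : 0 <= \int[normal_prob 0 s]_x (f b x)%:E by apply: integral_ge0.
move: ff; rewrite -/(f b).
(* Halving I + I <= 2 B in the extended reals: [ff] excludes +oo, nonnegativity excludes -oo. *)
case: (\int[normal_prob 0 s]_x (f b x)%:E) => [r| |]//=.
by rewrite -EFinD !lee_fin => + _; lra.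
Qed.

End normal_law.

(** * Moments under independent draws *)

Section iid_real.
Context {R : realType}.
Local Open Scope ereal_scope.
Variable P : probability (measurableTypeR R) R.

(** The one-dimensional hypothesis, for every offset, stands in for mean zero and variance at most
    [v]. The free offset [a] carries the induction: once the first coordinate x is fixed, it becomes
    [a + b ord0 * x]. *)
Lemma iid_affine_sqr_le (v : R) n (a : R) (b : 'I_n -> R) :
  (forall a b : R,
    \int[P]_x ((a + b * x) ^+ 2)%:E <= (a ^+ 2 + v * b ^+ 2)%:E) ->
  \int[iid P n]_t ((a + \sum_(i < n) b i * tnth t i) ^+ 2)%:E
    <= (a ^+ 2 + v * \sum_(i < n) b i ^+ 2)%:E.
Proof.
move=> Pv; elim: n a b => [|n IH] a b.
  apply: nnintegral_le_cst => t; rewrite lee_fin ?sqr_ge0//.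
  by rewrite !big_ord0 mulr0 !addr0.
apply: (@integral_iid_cons_le _ _ _ P _ _ (fun x =>
  ((a + b ord0 * x) ^+ 2)%:E + (v * \sum_(i < n) b (lift ord0 i) ^+ 2)%:E)).
- apply/measurable_EFinP; apply: measurable_funX; apply: measurable_funD => //.
  apply: measurable_sum => i; apply: measurable_funM => //.
  exact: measurable_tnth.
- by move=> t; rewrite lee_fin sqr_ge0.
- move=> x; rewrite -EFinD.
  apply: le_trans (IH (a + b ord0 * x)%R (fun i => b (lift ord0 i))).
  apply: le_nnintegral => t; rewrite lee_fin ?sqr_ge0//.
  rewrite big_ord_recl addrA tnth0.
  by under eq_bigr do rewrite tnthS.
have v0 : (0 <= v)%R.
  have := Pv 0%R 1%R; rewrite expr0n expr1n add0r mulr1 -lee_fin.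
  by apply: le_trans; apply: integral_ge0 => x _; rewrite lee_fin sqr_ge0.
rewrite ge0_integralD//; last 3 first.
- by move=> x _; rewrite lee_fin sqr_ge0.
- apply/measurable_EFinP; apply: measurable_funX.
  by apply: measurable_funD => //; exact: measurable_funM.
- by move=> x _; rewrite lee_fin mulr_ge0// sumr_ge0// => i _; rewrite sqr_ge0.
rewrite integral_cst// [X in (_ * X)%E](@probability_setT _ _ _ P) mule1.
by rewrite big_ord_recl mulrDr addrA EFinD leeD2r.
Qed.

Lemma iid_expR_sqr_le (k a q : R) n :
  \int[P]_x (expR (a - k * x ^+ 2))%:E <= q%:E ->
  \int[iid P n]_t (expR (\sum_(i < n) (a - k * tnth t i ^+ 2)))%:E
    <= (q ^+ n)%:E.
Proof.
move=> Pq; have q0 : (0 <= q)%R.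
  rewrite -lee_fin; apply: le_trans Pq.
  by apply: integral_ge0 => x _; rewrite lee_fin expR_ge0.
elim: n => [|n IH].
  apply: nnintegral_le_cst => t; rewrite lee_fin ?expR_ge0//.
  by rewrite big_ord0 expR0 expr0.
have me1 : measurable_fun setT
    (fun x : measurableTypeR R => (expR (a - k * x ^+ 2))%:E).
  apply/measurable_EFinP; apply: measurableT_comp => //.
  apply: measurable_funB => //; apply: measurable_funM => //.
have me j : measurable_fun setT
    (fun t : rvec R j => (expR (\sum_(i < j) (a - k * tnth t i ^+ 2)))%:E).
  apply/measurable_EFinP; apply: measurableT_comp => //.
  apply: measurable_sum => i; apply: measurable_funB => //.
  apply: measurable_funM => //; apply: measurable_funX.
  exact: measurable_tnth.
apply: (@integral_iid_cons_le _ _ _ P _ _ (fun x =>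
  (q ^+ n)%:E * (expR (a - k * x ^+ 2))%:E)) => //.
- move=> x; rewrite (eq_integral (fun t : rvec R n =>
    (expR (a - k * x ^+ 2))%:E *
    (expR (\sum_(i < n) (a - k * tnth t i ^+ 2)))%:E)); last first.
    move=> t _; rewrite -EFinM -expRD big_ord_recl tnth0.
    by under eq_bigr do rewrite tnthS.
  rewrite ge0_integralZl ?lee_fin ?expR_ge0//.
    by rewrite muleC lee_wpmul2r// lee_fin expR_ge0.
  exact: me.
rewrite ge0_integralZl ?lee_fin ?exprn_ge0//.
by rewrite exprSr EFinM lee_wpmul2l// lee_fin exprn_ge0.
Qed.

End iid_real.

Lemma integral_iid_sum_le {d} {T : measurableType d} {R : realType}
    (P : probability T R) (g : T -> R) (q : R) n :
  measurable_fun setT g -> (forall x, 0 <= g x) ->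
  (\int[P]_x (g x)%:E <= q%:E)%E ->
  (\int[iid P n]_t (\sum_(i < n) g (tnth t i))%:E <= (n%:R * q)%:E)%E.
Proof.
move=> mg g0 gq; elim: n => [|n IH].
  apply: nnintegral_le_cst => t; rewrite lee_fin ?sumr_ge0//.
  by rewrite big_ord0 mul0r.
have mS j : measurable_fun setT
    (fun t : j.-tuple T => (\sum_(i < j) g (tnth t i))%:E).
  apply/measurable_EFinP; apply: measurable_sum => i.
  by apply: measurableT_comp => //; exact: measurable_tnth.
apply: (@integral_iid_cons_le _ _ _ P _ _ (fun x =>
  (g x)%:E + (n%:R * q)%:E)%E) => //.
- by move=> t; rewrite lee_fin sumr_ge0.
- move=> x; rewrite (eq_integral (fun t : n.-tuple T =>
    ((g x)%:E + (\sum_(i < n) g (tnth t i))%:E)%E)); last first.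
    move=> t _; rewrite -EFinD big_ord_recl tnth0.
    by under eq_bigr do rewrite tnthS.
  rewrite ge0_integralD ?lee_fin//; last 2 first.
  - by move=> t _; rewrite lee_fin sumr_ge0.
  - exact: mS.
  rewrite integral_cst// [X in (_ * X)%E](@probability_setT _ _ _ (iid P n)).
  by rewrite mule1 leeD2l.
have q0 : 0 <= q.
  by rewrite -lee_fin; apply: le_trans gq; apply: integral_ge0 => x _;
    rewrite lee_fin.
rewrite ge0_integralD ?lee_fin ?mulr_ge0//; last 2 first.
- by move=> x _; rewrite lee_fin.
- exact/measurable_EFinP.
rewrite integral_cst// [X in (_ * X)%E](@probability_setT _ _ _ P).
have -> : n.+1%:R * q = q + n%:R * q by rewrite -natr1; ring.
by rewrite mule1 EFinD; apply: leeD.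
Qed.

Section gaussian_noise.
Context {R : realType} {D : nat}.
Local Notation datum := (bool * rvec R D)%type.
Hypothesis D_gt0 : (0 < D)%N.
Local Open Scope ereal_scope.

Let D0 : (0 < D%:R :> R)%R. Proof. by rewrite ltr0n. Qed.

Let sd_gt0 : (0 < Num.sqrt (32 / D%:R) :> R)%R.
Proof. by rewrite sqrtr_gt0 divr_gt0. Qed.

Let sd_sqr : (Num.sqrt (32 / D%:R) ^+ 2 = 32 / D%:R :> R)%R.
Proof. by rewrite sqr_sqrtr// divr_ge0. Qed.

Lemma noise_affine_sqr_le (a : R) (b : 'I_D -> R) :
  \int[@noise R D]_x ((a + \sum_(i < D) b i * tnth x i) ^+ 2)%:E
    <= (a ^+ 2 + 192 / D%:R * \sum_(i < D) b i ^+ 2)%:E.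
Proof.
apply: iid_affine_sqr_le => a' b'.
apply: le_trans (normal_affine_sqr_le a' b' sd_gt0) _.
by rewrite lee_fin sd_sqr; lra.
Qed.

(* The rate 3 D / 64 is 3 / (2 sigma^2) for the variance sigma^2 = 32 / D. *)
Lemma noise_expR_le :
  \int[@noise R D]_x
    (expR (\sum_(i < D) (3 / 8 - 3 * D%:R / 64 * tnth x i ^+ 2)))%:E
    <= ((4 / 5) ^+ D)%:E.
Proof.
apply: iid_expR_sqr_le; set s := Num.sqrt _.
have s20 : (0 < s / 2)%R by rewrite divr_gt0.
rewrite (eq_integral (fun x : measurableTypeR R =>
  (expR (3 / 8))%:E * (expR ((s ^- 2 - (s / 2) ^- 2) / 2 * x ^+ 2))%:E)).
  rewrite ge0_integralZl//; last first.
    apply/measurable_EFinP; apply: measurableT_comp => //.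
    by apply: measurable_funM => //; exact: measurable_funX.
  rewrite normal_exp_sqr// -EFinM lee_fin.
  have -> : (s / 2 / s = 2^-1)%R by field; rewrite gt_eqF.
  (* exp (-3/8) >= 5/8 gives exp (3/8) / 2 <= 4/5. *)
  have := expR_ge1Dx (- (3 / 8) : R)%R; rewrite expRN => e38.
  have e0 := expR_gt0 (3 / 8 : R)%R.
  have : ((1 + - (3 / 8)) * expR (3 / 8) <= 1 :> R)%R.
    by rewrite -ler_pdivlMr// div1r.
  lra.
move=> x _; rewrite -EFinM -expRD; congr (expR _)%:E.
have -> : ((s / 2) ^+ 2 = s ^+ 2 / 4)%R by field.
by rewrite sd_sqr; field; rewrite gt_eqF.
Qed.

Definition coin_noise : probability datum R :=
  (bernoulli_prob (2^-1 : R) \x @noise R D).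

Lemma coin_noise_le (f : datum -> \bar R) (B : R) :
  measurable_fun setT f -> (forall z, 0 <= f z) ->
  (forall y, \int[@noise R D]_x f (y, x) <= B%:E) ->
  \int[coin_noise]_z f z <= B%:E.
Proof.
move=> mf f0 fB; rewrite /coin_noise /= fubini_tonelli1//.
by apply: nnintegral_le_cst => // y; exact: integral_ge0.
Qed.

Definition flip_noise (z : datum) : datum :=
  (z.1, [tuple of map -%R z.2]).

Let measurable_oppr_rvec :
  measurable_fun setT (fun x : rvec R D => [tuple of map -%R x] : rvec R D).
Proof.
by apply: measurable_map_tuple; exact: oppr_measurable.
Qed.

Lemma measurable_flip_noise : measurable_fun setT flip_noise.
Proof.
apply/measurable_fun_pairP; split; first exact: measurable_fst.
exact: (measurableT_comp measurable_oppr_rvec measurable_snd).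
Qed.

Lemma image_law_flip_noise : image_law coin_noise flip_noise coin_noise.
Proof.
have Ibool : image_law (bernoulli_prob (2^-1 : R)) idfun
    (bernoulli_prob (2^-1 : R)) by [].
have Inoise : image_law (@noise R D)
    (fun x : rvec R D => [tuple of map -%R x] : rvec R D) (@noise R D).
  apply: image_law_iid; first exact: oppr_measurable.
  by apply: image_law_normalN; rewrite gt_eqF.
exact: (image_law_prod _ measurable_oppr_rvec Ibool Inoise).
Qed.

Definition weight n (s : n.-tuple datum) (d : 'I_D) : R :=
  (\sum_(i < n) label (tnth s i).1 * tnth (tnth s i).2 d)%R.

Lemma weight_cons n z (s : n.-tuple datum) d :
  (weight [tuple of z :: s] d = label z.1 * tnth z.2 d + weight s d)%R.
Proof.
rewrite /weight big_ord_recl tnth0; congr +%R.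
by apply: eq_bigr => i _; rewrite tnthS.
Qed.

(** This vector does not depend on example [i], so its inner product with the noise of example [i]
    is a centred linear form once the other examples are fixed. *)
Definition leave_one_out n (s : n.-tuple datum) (i : 'I_n) (d : 'I_D) : R :=
  (weight s d - label (tnth s i).1 * tnth (tnth s i).2 d)%R.

Lemma measurable_noise_coord d :
  measurable_fun setT (fun z : datum => tnth z.2 d).
Proof.
exact: (measurableT_comp (measurable_tnth d) measurable_snd).
Qed.

Lemma measurable_label : measurable_fun setT (fun z : datum => label z.1 : R).
Proof. exact: (measurableT_comp (f := @label R)). Qed.

Lemma measurable_tuple_coord n (i : 'I_n) d :
  measurable_fun setT (fun s : n.-tuple datum => tnth (tnth s i).2 d).
Proof.
exact: (measurableT_comp (measurable_noise_coord d) (measurable_tnth i)).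
Qed.

Lemma measurable_tuple_label n (i : 'I_n) :
  measurable_fun setT (fun s : n.-tuple datum => label (tnth s i).1 : R).
Proof. exact: (measurableT_comp measurable_label (measurable_tnth i)). Qed.

Lemma measurable_weight n d :
  measurable_fun setT (fun s : n.-tuple datum => weight s d).
Proof.
apply: measurable_sum => i; apply: measurable_funM.
  exact: measurable_tuple_label.
exact: measurable_tuple_coord.
Qed.

Lemma measurable_leave_one_out n (i : 'I_n) d :
  measurable_fun setT (fun s : n.-tuple datum => leave_one_out s i d).
Proof.
apply: measurable_funB; first exact: measurable_weight.
apply: measurable_funM; first exact: measurable_tuple_label.
exact: measurable_tuple_coord.
Qed.

End gaussian_noise.

(** * Moments of the learned weights *)

Section random_weights.
Context {R : realType} {D : nat}.
Local Notation datum := (bool * rvec R D)%type.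
Local Notation v := (192 / D%:R : R).
Local Open Scope ereal_scope.
Hypothesis D_gt0 : (0 < D)%N.

Let D0 : (0 < D%:R :> R)%R. Proof. by rewrite ltr0n. Qed.

Let v0 : (0 <= v)%R. Proof. by rewrite divr_ge0. Qed.

Lemma noise_shift_sqr_le (y : R) (c : 'I_D -> R) : (y ^+ 2 = 1)%R ->
  \int[@noise R D]_x (\sum_(d < D) (c d + y * tnth x d) ^+ 2)%:E
    <= (\sum_(d < D) c d ^+ 2 + 192)%:E.
Proof.
move=> y1.
rewrite (eq_integral (fun x : rvec R D =>
    \sum_(d < D) ((c d + y * tnth x d) ^+ 2)%:E)); last first.
  by move=> x _; rewrite sumEFin.
rewrite ge0_integral_sum//; last 2 first.
- move=> d; apply/measurable_EFinP; apply: measurable_funX.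
  apply: measurable_funD => //; apply: measurable_funM => //.
  exact: measurable_tnth.
- by move=> d x _; rewrite lee_fin sqr_ge0.
have -> : (192 = \sum_(d < D) v :> R)%R.
  by rewrite sumr_const card_ord -[RHS]mulr_natr divfK ?gt_eqF.
rewrite -big_split/= -sumEFin; apply: lee_sum => d _.
(* Coordinate [d] is written as a linear form in the whole noise vector, with coefficients [y] times
   the d-th unit vector. *)
apply: le_trans (_ : (c d ^+ 2 + v * \sum_(e < D)
  (if e == d then y else 0) ^+ 2)%:E <= _); last first.
  rewrite lee_fin (bigD1 d)//= eqxx y1 big1 ?addr0 ?mulr1// => e /negbTE ->.
  by rewrite expr0n.
apply: le_trans (noise_affine_sqr_le D_gt0 _ _).
apply: le_nnintegral => x; rewrite lee_fin ?sqr_ge0//.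
rewrite (bigD1 d)//= eqxx big1 ?addr0// => e /negbTE ->.
by rewrite mul0r.
Qed.

Lemma label_sqr b : (label b ^+ 2 = 1 :> R)%R.
Proof. by case: b; rewrite /label ?sqrrN expr1n. Qed.

Lemma coin_noise_shift_sqr_le (c : 'I_D -> R) :
  \int[coin_noise]_z (\sum_(d < D) (c d + label z.1 * tnth z.2 d) ^+ 2)%:E
    <= (\sum_(d < D) c d ^+ 2 + 192)%:E.
Proof.
apply: coin_noise_le.
- apply/measurable_EFinP; apply: measurable_sum => d; apply: measurable_funX.
  apply: measurable_funD => //; apply: measurable_funM.
    exact: measurable_label.
  exact: measurable_noise_coord.
- by move=> z; rewrite lee_fin sumr_ge0// => d _; rewrite sqr_ge0.
- by move=> y; apply: noise_shift_sqr_le; exact: label_sqr.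
Qed.

Lemma measurable_shift_weight n (c : 'I_D -> R) :
  measurable_fun setT (fun s : n.-tuple datum =>
    (\sum_(d < D) (c d + weight s d) ^+ 2)%:E).
Proof.
apply/measurable_EFinP; apply: measurable_sum => d; apply: measurable_funX.
by apply: measurable_funD => //; exact: measurable_weight.
Qed.

Lemma integral_weight_sqr_le n (c : 'I_D -> R) :
  \int[iid coin_noise n]_s (\sum_(d < D) (c d + weight s d) ^+ 2)%:E
    <= (\sum_(d < D) c d ^+ 2 + n%:R * 192)%:E.
Proof.
have S0 m (s : m.-tuple datum) (c' : 'I_D -> R) :
    0 <= (\sum_(d < D) (c' d + weight s d) ^+ 2)%:E.
  by rewrite lee_fin sumr_ge0// => d _; rewrite sqr_ge0.
elim: n c => [|n IH] c.
  apply: nnintegral_le_cst => // s; rewrite lee_fin mul0r addr0.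
  by apply: ler_sum => d _; rewrite /weight big_ord0 addr0.
apply: (@integral_iid_cons_le _ _ _ _ _ _ (fun z : datum =>
  (\sum_(d < D) (c d + label z.1 * tnth z.2 d) ^+ 2)%:E + (n%:R * 192)%:E)).
- exact: measurable_shift_weight.
- by move=> s.
- move=> z; rewrite -EFinD.
  apply: le_trans (IH (fun d => c d + label z.1 * tnth z.2 d)%R).
  apply: le_nnintegral => s //; rewrite lee_fin.
  by apply: ler_sum => d _; rewrite weight_cons addrA.
rewrite ge0_integralD//; last 2 first.
- by move=> z _; rewrite lee_fin sumr_ge0// => d _; rewrite sqr_ge0.
- apply/measurable_EFinP; apply: measurable_sum => d; apply: measurable_funX.
  apply: measurable_funD => //; apply: measurable_funM.
    exact: measurable_label.
  exact: measurable_noise_coord.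
rewrite integral_cst// [X in (_ * X)%E](@probability_setT _ _ _ coin_noise).
rewrite mule1; have -> : (n.+1%:R * 192 = 192 + n%:R * 192 :> R)%R.
  by rewrite -natr1; ring.
by rewrite addrA [leRHS]EFinD leeD2r// coin_noise_shift_sqr_le.
Qed.

(** For [c = 0] this is the total squared interaction of each noise vector with the rest of w_2. The
    offset [c] exists for induction: it accumulates the examples already split off. *)
Definition cross_energy n (c : 'I_D -> R) (s : n.-tuple datum) : R :=
  (\sum_(i < n) (\sum_(d < D)
    tnth (tnth s i).2 d * (c d + leave_one_out s i d)) ^+ 2)%R.

Lemma cross_energy_ge0 n c (s : n.-tuple datum) : (0 <= cross_energy c s)%R.
Proof. by apply: sumr_ge0 => i _; rewrite sqr_ge0. Qed.

Lemma measurable_cross_energy n (c : 'I_D -> R) :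
  measurable_fun setT (fun s : n.-tuple datum => (cross_energy c s)%:E).
Proof.
apply/measurable_EFinP; apply: measurable_sum => i; apply: measurable_funX.
apply: measurable_sum => d; apply: measurable_funM.
  exact: measurable_tuple_coord.
by apply: measurable_funD => //; exact: measurable_leave_one_out.
Qed.

Lemma cross_energy_cons n c z (s : n.-tuple datum) :
  (cross_energy c [tuple of z :: s] =
   (\sum_(d < D) tnth z.2 d * (c d + weight s d)) ^+ 2 +
   cross_energy (fun d => c d + label z.1 * tnth z.2 d) s)%R.
Proof.
rewrite /cross_energy big_ord_recl tnth0; congr (_ ^+ 2 + _)%R.
  apply: eq_bigr => d _; rewrite /leave_one_out weight_cons tnth0.
  by congr (_ * _)%R; ring.
apply: eq_bigr => i _; rewrite tnthS; congr (_ ^+ 2)%R.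
apply: eq_bigr => d _; rewrite /leave_one_out weight_cons tnthS.
by congr (_ * _)%R; ring.
Qed.

Lemma integral_cross_energy_le n (c : 'I_D -> R) :
  \int[iid coin_noise n]_s (cross_energy c s)%:E
    <= (n%:R * v * (\sum_(d < D) c d ^+ 2 + n%:R * 192))%:E.
Proof.
elim: n c => [|n IH] c.
  apply: nnintegral_le_cst => s; rewrite lee_fin ?cross_energy_ge0//.
  by rewrite /cross_energy big_ord0 !mul0r.
pose f (zs : datum * n.-tuple datum) :=
  ((\sum_(d < D) tnth zs.1.2 d * (c d + weight zs.2 d)) ^+ 2)%:E : \bar R.
have f0 zs : 0 <= f zs by rewrite lee_fin sqr_ge0.
have mf : measurable_fun setT f.
  apply/measurable_EFinP; apply: measurable_funX; apply: measurable_sum => d.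
  apply: measurable_funM.
    exact: (measurableT_comp (measurable_noise_coord d) measurable_fst).
  apply: measurable_funD => //.
  have mw : measurable_fun setT (fun s : n.-tuple datum => weight s d).
    exact: measurable_weight.
  exact: (measurableT_comp mw measurable_snd).
pose A (z : datum) := \int[iid coin_noise n]_s f (z, s).
have mA : measurable_fun setT A by exact: measurable_fun_fubini_tonelli_F.
have A0 z : 0 <= A z by exact: integral_ge0.
pose S : R := (\sum_(d < D) c d ^+ 2)%R.
pose T (z : datum) : R :=
  (\sum_(d < D) (c d + label z.1 * tnth z.2 d) ^+ 2)%R.
have T0 z : (0 <= T z)%R by apply: sumr_ge0 => d _; rewrite sqr_ge0.
have mT : measurable_fun setT T.
  apply: measurable_sum => d; apply: measurable_funX.
  apply: measurable_funD => //; apply: measurable_funM.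
    exact: measurable_label.
  exact: measurable_noise_coord.
have IA : \int[coin_noise]_z A z <= (v * (S + n%:R * 192))%:E.
  (* The first example is integrated before the others: with these fixed, its term is the square of
     a centred linear form with coefficients [c d + weight s d]. *)
  rewrite /A fubini_tonelli//.
  apply: (@le_trans _ _ (\int[iid coin_noise n]_s
      (v%:E * (\sum_(d < D) (c d + weight s d) ^+ 2)%:E))).
    apply: le_nnintegral => s; first exact: integral_ge0.
    rewrite -EFinM; apply: coin_noise_le => //.
      exact: (measurableT_comp mf (measurable_pair2 _)).
    move=> y; have := noise_affine_sqr_le D_gt0 0 (fun d => c d + weight s d)%R.
    rewrite expr0n add0r; apply: le_trans; apply: le_nnintegral => // x.
    rewrite lee_fin add0r.
    by under eq_bigr do rewrite mulrC.
  rewrite ge0_integralZl//; last 2 first.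
  - exact: measurable_shift_weight.
  - by move=> s _; rewrite lee_fin sumr_ge0// => d _; rewrite sqr_ge0.
  by rewrite [leRHS]EFinM lee_wpmul2l ?lee_fin// integral_weight_sqr_le.
have nv0 : (0 <= n%:R * v)%R by rewrite mulr_ge0.
apply: (@integral_iid_cons_le _ _ _ _ _ _ (fun z : datum =>
  A z + (n%:R * v * (T z + n%:R * 192))%:E)).
- exact: measurable_cross_energy.
- by move=> s; rewrite lee_fin cross_energy_ge0.
- move=> z; rewrite (eq_integral (fun s : n.-tuple datum => f (z, s) +
    (cross_energy (fun d => c d + label z.1 * tnth z.2 d)%R s)%:E)).
    rewrite ge0_integralD//; last 3 first.
    - exact: (measurableT_comp mf (measurable_pair1 _)).
    - by move=> s _; rewrite lee_fin cross_energy_ge0.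
    - exact: measurable_cross_energy.
    by rewrite leeD2l.
  by move=> s _; rewrite cross_energy_cons EFinD.
rewrite ge0_integralD//; last 2 first.
- by move=> z _; rewrite lee_fin mulr_ge0// addr_ge0// mulr_ge0.
- apply/measurable_EFinP; apply: measurable_funM => //.
  exact: measurable_funD.
have IT : \int[coin_noise]_z (n%:R * v * (T z + n%:R * 192))%:E
    <= (n%:R * v * (S + 192 + n%:R * 192))%:E.
  under eq_integral do rewrite EFinM.
  rewrite ge0_integralZl//; last 2 first.
  - by apply/measurable_EFinP; exact: measurable_funD.
  - by move=> z _; rewrite lee_fin addr_ge0// mulr_ge0.
  rewrite [leRHS]EFinM lee_wpmul2l ?lee_fin//.
  under eq_integral do rewrite EFinD.
  rewrite ge0_integralD//; last 2 first.
  - by move=> z _; rewrite lee_fin.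
  - exact/measurable_EFinP.
  rewrite integral_cst// [X in (_ * X)%E](@probability_setT _ _ _ coin_noise).
  by rewrite mule1 [leRHS]EFinD leeD2r// coin_noise_shift_sqr_le.
apply: (le_trans (leeD IA IT)); rewrite -EFinD lee_fin -/S.
have n0 : (0 <= n%:R :> R)%R by [].
(* The slack of [192 * v] per step comes from counting n^2 ordered pairs of examples instead of n (n
   - 1). *)
rewrite -natr1 -subr_ge0.
rewrite (_ : (_ - _ = v * 192)%R) ?mulr_ge0//.
by ring.
Qed.

End random_weights.

(** * Transport of events and choice of a good data set *)

Lemma image_law_measure {R : realType} {d d'} {T : measurableType d}
    {T' : measurableType d'} (P : probability T R) (phi : T -> T')
    (P' : probability T' R) (A : set T') :
  measurable_fun setT phi -> image_law P phi P' -> measurable A ->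
  P' A = P (phi @^-1` A).
Proof.
move=> mphi I mA.
have mpA : measurable (phi @^-1` A).
  by rewrite -[X in measurable X]setTI; exact: mphi.
have E (x : T') : (0 <= (\1_A x : R)%:E)%E by rewrite lee_fin.
have mE : measurable_fun setT (fun x : T' => (\1_A x : R)%:E).
  exact/measurable_EFinP/measurable_indic.
by have := I _ mE E; rewrite !integral_indic// !setIT => ->.
Qed.

(* Without such a point, [1 <= \1_A + \1_B + 2 f] holds everywhere: integrate. *)
Lemma exists_avoiding {R : realType} {d} {T : measurableType d}
    (P : probability T R) (A B : set T) (f : T -> R) (a b c : R) :
  measurable A -> measurable B -> measurable_fun setT f ->
  (forall x, 0 <= f x) ->
  (P A <= a%:E)%E -> (P B <= b%:E)%E -> (\int[P]_x (f x)%:E <= c%:E)%E ->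
  a + b + 2 * c < 1 ->
  exists x, [/\ ~ A x, ~ B x & f x <= 1 / 2].
Proof.
move=> mA mB mf f0 PA PB If abc; apply: contrapT => /forallNP noE.
have : (1%:E <= (a + b + 2 * c)%:E :> \bar R)%E; last first.
  by rewrite lee_fin leNgt abc.
have mI (C : set T) : measurable C ->
    measurable_fun setT (fun x : T => (\1_C x : R)%:E).
  by move=> mC; apply/measurable_EFinP; exact: measurable_indic.
have m2f : measurable_fun setT (fun x : T => (2 * f x)%:E).
  by apply/measurable_EFinP; exact: measurable_funM.
have f20 (x : T) : (0 <= (2 * f x)%:E)%E by rewrite lee_fin mulr_ge0.
rewrite -(@probability_setT _ _ _ P) -[leLHS]mul1e -integral_cst//.
apply: (@le_trans _ _ (\int[P]_x
  ((\1_A x)%:E + (\1_B x)%:E + (2 * f x)%:E))%E).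
  apply: le_nnintegral => x /=; first by rewrite lee_fin.
  rewrite -!EFinD lee_fin !indicE.
  have [xA|xA] := boolP (x \in A).
    by rewrite -addrA lerDl addr_ge0// mulr_ge0.
  have [xB|xB] := boolP (x \in B).
    by rewrite add0r lerDl mulr_ge0.
  rewrite !add0r leNgt; apply/negP => fx; apply: (noE x); split.
  - by rewrite notin_setE in xA.
  - by rewrite notin_setE in xB.
  - lra.
rewrite ge0_integralD//; last 2 first.
- by move=> x _; rewrite adde_ge0 ?lee_fin.
- by apply: emeasurable_funD; exact: mI.
rewrite ge0_integralD//; try exact: mI.
rewrite !integral_indic// !setIT !EFinD leeD// ?leeD//.
under eq_integral do rewrite EFinM.
rewrite ge0_integralZl//; last 2 first.
- exact/measurable_EFinP.
- by move=> x _; rewrite lee_fin.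
by rewrite EFinM lee_wpmul2l.
Qed.

(** * Relative entropy of Bernoulli laws *)

Section kl_lower_bound.
Context {R : realType}.
Implicit Types a b : R.

(* From [ln x <= x - 1] at [x = sqrt (b / a)]. *)
Lemma kl_term_ge a b : 0 <= a -> 0 <= b ->
  ((2 * a - 2 * (Num.sqrt a * Num.sqrt b))%:E <= kl_term a b)%E.
Proof.
move=> a0 b0; rewrite /kl_term.
have [->|an0] := eqVneq a 0; first by rewrite sqrtr0 mul0r !mulr0 subrr.
have [->|bn0] := eqVneq b 0; first by rewrite leey.
have {an0}a0 : 0 < a by rewrite lt_def an0.
have {bn0}b0 : 0 < b by rewrite lt_def bn0.
rewrite lee_fin; set p := Num.sqrt a; set q := Num.sqrt b.
have p0 : 0 < p by rewrite sqrtr_gt0.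
have q0 : 0 < q by rewrite sqrtr_gt0.
have aE : a = p ^+ 2 by rewrite sqr_sqrtr// ltW.
have bE : b = q ^+ 2 by rewrite sqr_sqrtr// ltW.
have -> : a / b = ((q / p) ^+ 2)^-1.
  by rewrite aE bE; field; rewrite !gt_eqF.
have qp0 : 0 < q / p by rewrite divr_gt0.
rewrite lnV ?posrE ?exprn_gt0// lnXn//.
have lnle : ln (q / p) <= q / p - 1.
  by have := @le_ln1Dx R (q / p - 1); rewrite subrKC; apply; lra.
rewrite aE; have -> : 2 * p ^+ 2 - 2 * (p * q) = p ^+ 2 * - ((q / p - 1) *+ 2).
  by field; rewrite gt_eqF.
by rewrite ler_wpM2l ?sqr_ge0// lerN2 lerMn2r.
Qed.

(** The two bounds of [kl_term_ge] add up to the squared Hellinger distance (p - q)^2 + (p' - q')^2,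
    since p^2 + p'^2 = q^2 + q'^2 = 1. Each square is at least (a - b)^2 / 4, because p + q <= 2 and
    p' + q' <= 2. This weak form of Pinsker's inequality already matches the term sqrt (2
    eps_pb). *)
Lemma kl_bernoulli_ge a b : 0 <= a <= 1 -> 0 <= b <= 1 ->
  (((a - b) ^+ 2 / 2)%:E <= kl_bernoulli a b)%E.
Proof.
move=> /andP[a0 a1] /andP[b0 b1].
have a'0 : 0 <= 1 - a by rewrite subr_ge0.
have b'0 : 0 <= 1 - b by rewrite subr_ge0.
apply: le_trans (leeD (kl_term_ge a0 b0) (kl_term_ge a'0 b'0)).
rewrite -EFinD lee_fin.
set p := Num.sqrt a; set q := Num.sqrt b.
set p' := Num.sqrt (1 - a); set q' := Num.sqrt (1 - b).
have aE : p ^+ 2 = a by rewrite sqr_sqrtr.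
have bE : q ^+ 2 = b by rewrite sqr_sqrtr.
have a'E : p' ^+ 2 = 1 - a by rewrite sqr_sqrtr.
have b'E : q' ^+ 2 = 1 - b by rewrite sqr_sqrtr.
have bnd (x y : R) : x ^+ 2 <= 1 -> y ^+ 2 <= 1 ->
    (x ^+ 2 - y ^+ 2) ^+ 2 <= 4 * (x - y) ^+ 2.
  move=> x1 y1; rewrite subr_sqr exprMn mulrC ler_wpM2r ?sqr_ge0//.
  have : 0 <= (x - y) ^+ 2 by rewrite sqr_ge0.
  by rewrite sqrrB sqrrD; lra.
have h1 : (a - b) ^+ 2 <= 4 * (p - q) ^+ 2.
  by rewrite -aE -bE bnd// ?aE ?bE.
have h2 : (a - b) ^+ 2 <= 4 * (p' - q') ^+ 2.
  have -> : a - b = (1 - b) - (1 - a) by ring.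
  rewrite -sqrrN opprB -a'E -b'E bnd ?a'E ?b'E//; lra.
move: h1 h2; rewrite !sqrrB aE bE a'E b'E; lra.
Qed.

Lemma sub_le_kl_bernoulli a b (e : \bar R) : 0 <= a <= 1 -> 0 <= b <= 1 ->
  (kl_bernoulli a b <= e)%E ->
  ((a - b)%:E <= (2%:E * e) `^ 2^-1 + 2%:E * e)%E.
Proof.
move=> a01 b01 /(le_trans (kl_bernoulli_ge a01 b01)).
(* An infinite [e] makes the right-hand side +oo; -oo is excluded by the real lower bound. *)
case: e => [r| |//]; last first.
  by move=> _; rewrite gt0_muley ?lte_fin// poweRyr ?invr_eq0// leey.
rewrite lee_fin => abr.
have ab2 : (a - b) ^+ 2 <= 2 * r by lra.
have r0 : 0 <= 2 * r := le_trans (sqr_ge0 _) ab2.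
rewrite -EFinM poweR_EFin -EFinD lee_fin powR12_sqrt//.
apply: (le_trans (ler_norm _)); rewrite -sqrtr_sqr.
apply: (@le_trans _ _ (Num.sqrt (2 * r))); last by rewrite lerDl.
by rewrite ler_sqrt.
Qed.

End kl_lower_bound.

(** * From the PAC-Bayesian inequality to the derandomized bound *)

Section derandomization.
Context {R : realType} {dH dZ : measure_display}.
Context {H : measurableType dH} {Z : measurableType dZ}.
Variables (loss : H -> Z -> R) (mu : probability Z R).
Hypothesis loss01 : forall h z, 0 <= loss h z <= 1.
Variables (m : nat) (delta : R).

Lemma risk01 h : 0 <= risk loss mu h <= 1.
Proof. exact: Rintegral_itv01. Qed.

Lemma emp_risk01 (S : m.-tuple Z) h : 0 <= emp_risk loss S h <= 1.
Proof.
have l0 z : 0 <= loss h z by case/andP: (loss01 h z).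
have l1 z : loss h z <= 1 by case/andP: (loss01 h z).
rewrite /emp_risk mulr_ge0 ?sumr_ge0//=.
case: m S => [|n] S; first by rewrite big_ord0 mulr0.
rewrite ler_pdivrMl ?ltr0n// mulr1.
apply: (@le_trans _ _ (\sum_(i < n.+1) 1)); first exact: ler_sum.
by rewrite sumr_const card_ord.
Qed.

(* The three error terms telescope along
   emp_risk h, E_Q emp_risk, E_Q risk, risk h. *)
Lemma derandomized_bound_ge (P Q : probability H R) h (S : m.-tuple Z) :
  pac_bayes_ineq loss mu delta P S ->
  ((emp_risk loss S h - risk loss mu h)%:E <=
    derandomized_bound loss mu delta P Q h S)%E.
Proof.
move=> /(_ Q) PB; rewrite /derandomized_bound /gap_risk /gap_emp.
set a := \int[Q]_h emp_risk loss S h; set b := \int[Q]_h risk loss mu h.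
have a01 : 0 <= a <= 1 by apply: Rintegral_itv01 => h'; exact: emp_risk01.
have b01 : 0 <= b <= 1 by apply: Rintegral_itv01 => h'; exact: risk01.
have ab := sub_le_kl_bernoulli a01 b01 PB.
apply: (@le_trans _ _ ((a - b)%:E + `|risk loss mu h - b|%:E +
    `|emp_risk loss S h - a|%:E)%E); last by rewrite !leeD2r.
rewrite -!EFinD lee_fin.
have := ler_norm (emp_risk loss S h - a).
have := ler_norm (- (risk loss mu h - b)); rewrite normrN; lra.
Qed.

End derandomization.

(** * Sign-flipped noise *)

Lemma integral_lincomb_le {R : realType} {d} {T : measurableType d}
    (P : probability T R) (f g : T -> R) (k a b : R) :
  measurable_fun setT f -> measurable_fun setT g ->
  (forall x, 0 <= f x) -> (forall x, 0 <= g x) -> 0 <= k ->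
  (\int[P]_x (f x)%:E <= a%:E)%E -> (\int[P]_x (g x)%:E <= b%:E)%E ->
  (\int[P]_x (k * f x + g x)%:E <= (k * a + b)%:E)%E.
Proof.
move=> mf mg f0 g0 k0 fa gb.
have mF : measurable_fun setT (fun x : T => (f x)%:E) by exact/measurable_EFinP.
have mG : measurable_fun setT (fun x : T => (g x)%:E) by exact/measurable_EFinP.
have F0 (x : T) : (0 <= (f x)%:E)%E by rewrite lee_fin.
have G0 (x : T) : (0 <= (g x)%:E)%E by rewrite lee_fin.
rewrite (eq_integral (fun x => k%:E * (f x)%:E + (g x)%:E)%E)//.
rewrite ge0_integralD//; last 2 first.
- by move=> x _; rewrite mule_ge0.
- exact: emeasurable_funM.
by rewrite ge0_integralZl// EFinD EFinM leeD// lee_wpmul2l.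
Qed.

Section sign_flipped_noise.
Context {R : realType} {K D m : nat}.
Variable u : rvec R K.
Hypothesis D_gt0 : (0 < D)%N.
Hypothesis m_gt0 : (0 < m)%N.
Hypothesis norm_u : norm2 u = 1 / Num.sqrt m%:R.
Variable gamma : R.
Hypothesis gamma01 : 0 <= gamma <= 1.

Local Notation datum := (bool * rvec R D)%type.
Local Notation loss := (fun (h : hypothesis R K D) (z : sample R K D) =>
  ramp_loss gamma (output h z.1) (label z.2)).
Local Notation dataset s := [tuple of map (@make_sample R K D u) s].
Local Notation flip s := [tuple of map flip_noise s].

Let m0 : 0 < m%:R :> R. Proof. by rewrite ltr0n. Qed.
Let D0 : 0 < D%:R :> R. Proof. by rewrite ltr0n. Qed.

Lemma ramp_loss01 (y' y : R) : 0 <= ramp_loss gamma y' y <= 1.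
Proof.
rewrite /ramp_loss; case: (leP (y * y') 0) => [_|t0].
  by rewrite lexx ler01.
case: (ltP (y * y') gamma) => [tg|_]; last by rewrite lexx ler01.
have g0 : 0 < gamma := lt_trans t0 tg.
rewrite subr_ge0 ler_pdivrMr// mul1r ltW//= gerBl divr_ge0// ltW//.
Qed.

(** The parabola is centred at 4, the signal part of the learned margin, and equals 1 at margin 1.
    The loss is at most 1 to the left of that point and vanishes from there on, as gamma <= 1. *)
Lemma ramp_loss_le_sqr (y' y : R) :
  ramp_loss gamma y' y <= ((y * y' - 4) / 3) ^+ 2.
Proof.
have /andP[g0 g1] := gamma01.
have [t1|t1] := leP 1 (y * y').
  rewrite /ramp_loss; case: (leP (y * y') 0) => [t0|_]; first lra.
  by case: (ltP (y * y') gamma) => [tg|_]; [lra|rewrite sqr_ge0].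
apply: (@le_trans _ _ 1); first by case/andP: (ramp_loss01 y' y).
by nra.
Qed.

Lemma sum_sqr_u : \sum_(i < K) tnth u i ^+ 2 = m%:R^-1.
Proof.
have S0 : 0 <= \sum_(i < K) tnth u i ^+ 2.
  by apply: sumr_ge0 => i _; exact: sqr_ge0.
by rewrite -(sqr_sqrtr S0) -/(norm2 u) norm_u div1r exprVn sqr_sqrtr.
Qed.

(** The 4 is the inner product of w_1 = 2 m u with 2 y u, times y, with |u|^2 = 1/m. *)
Lemma margin_learn (s : m.-tuple datum) (z : datum) :
  label z.1 * output (learn (dataset s)) (make_sample u z).1 =
    4 + label z.1 * \sum_(d < D) weight s d * tnth z.2 d.
Proof.
rewrite learn_make_sample /output /= mulrDr; congr (_ + _ * _).
  rewrite /dotp (eq_bigr (fun i => 4 * m%:R * label z.1 * tnth u i ^+ 2)).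
    rewrite -mulr_sumr sum_sqr_u.
    have -> : label z.1 * (4 * m%:R * label z.1 * m%:R^-1) =
        4 * label z.1 ^+ 2 :> R by field; rewrite gt_eqF.
    by rewrite label_sqr mulr1.
  by move=> i _; rewrite !tnth_mktuple; ring.
rewrite /dotp; apply: eq_bigr => d _; rewrite tnth_mktuple; congr (_ * _).
by rewrite big_tuple.
Qed.

Lemma measurable_margin (h : hypothesis R K D) :
  measurable_fun setT (fun z : sample R K D => label z.2 * output h z.1).
Proof.
apply: measurable_funM.
  exact: (measurableT_comp (f := @label R)).
apply: measurable_funD; apply: measurable_sum => i; apply: measurable_funM => //.
- apply: (measurableT_comp (measurable_tnth i)).
  exact: (measurableT_comp measurable_fst measurable_fst).
- apply: (measurableT_comp (measurable_tnth i)).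
  exact: (measurableT_comp measurable_snd measurable_fst).
Qed.

(* ramp_loss_le_sqr dominates the loss on all samples, also off the support of
   data, by a polynomial in the margin; so measurability of the loss is avoided. *)
Lemma risk_learn_le (s : m.-tuple datum) :
  risk loss (data u) (learn (dataset s)) <=
    192 / D%:R / 9 * \sum_(d < D) weight s d ^+ 2.
Proof.
set h := learn _.
apply: Rintegral_le => [z|].
  by case/andP: (ramp_loss01 (output h z.1) (label z.2)).
pose g (z : sample R K D) : R := ((label z.2 * output h z.1 - 4) / 3) ^+ 2.
have mg : measurable_fun setT (fun z => (g z)%:E).
  apply/measurable_EFinP; apply: measurable_funX; apply: measurable_funM => //.
  by apply: measurable_funB => //; exact: measurable_margin.
have g0 z : (0 <= (g z)%:E)%E by rewrite lee_fin sqr_ge0.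
apply: (@le_trans _ _ (\int[data u]_z (g z)%:E)%E).
  apply: le_nnintegral => z; rewrite lee_fin; last exact: ramp_loss_le_sqr.
  by case/andP: (ramp_loss01 (output h z.1) (label z.2)).
rewrite (@image_law_distribution _ _ _ _ _ (@coin_noise R D) (make_sample u))//.
have mgs : measurable_fun setT (fun z : datum => (g (make_sample u z))%:E).
  exact: (measurableT_comp mg).
apply: coin_noise_le => // y.
have -> : 192 / D%:R / 9 * \sum_(d < D) weight s d ^+ 2 =
    0 ^+ 2 + 192 / D%:R * \sum_(d < D) (weight s d / 3) ^+ 2.
  rewrite expr0n add0r -mulrA; congr (_ * _); rewrite mulr_sumr.
  by apply: eq_bigr => d _; field.
apply: le_trans (noise_affine_sqr_le D_gt0 _ _).
apply: le_nnintegral => x //; rewrite lee_fin add0r /g.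
have := margin_learn s (y, x); rewrite -/h /= => ->.
rewrite addrAC subrr add0r !exprMn label_sqr mul1r -exprMn mulr_suml.
rewrite le_eqVlt; apply/orP; left; apply/eqP; congr (_ ^+ 2).
by apply: eq_bigr => d _; rewrite mulrAC.
Qed.

(** A Chernoff bound for short noise vectors: each exponent equals 3 D / 64 (8 - |x_i|^2). The
    threshold 8 lies well below the mean 32 of |x_i|^2, yet exceeds the signal 4 by another 4, which
    leaves room for the cross term. *)
Definition anticoncentration (s : m.-tuple datum) : R :=
  \sum_(i < m)
    expR (\sum_(d < D) (3 / 8 - 3 * D%:R / 64 * tnth (tnth s i).2 d ^+ 2)).

(* After the flip the margin is 4 - |x|^2 - y c, which is positive only if
   |x|^2 < 8, making the exponential at least 1, or c^2 > 16. *)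
Lemma loss_flip_ge (s : m.-tuple datum) (i : 'I_m) :
  1 - (expR (\sum_(d < D) (3 / 8 - 3 * D%:R / 64 * tnth (tnth s i).2 d ^+ 2)) +
    (\sum_(d < D) tnth (tnth s i).2 d * (0 + leave_one_out s i d)) ^+ 2 / 16)
  <= loss (learn (dataset s)) (make_sample u (flip_noise (tnth s i))).
Proof.
set E := expR _; set c := \sum_(d < D) _ * _.
set z := tnth s i; set h := learn _.
pose q := \sum_(d < D) tnth z.2 d ^+ 2.
have marginE : label z.1 * output h (make_sample u (flip_noise z)).1 =
    4 - q - label z.1 * c.
  have /= -> := margin_learn s (flip_noise z).
  rewrite -[RHS]addrA -opprD; congr (_ + _); rewrite /q /c !mulr_sumr.
  rewrite -big_split/= -sumrN; apply: eq_bigr => d _.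
  rewrite tnth_map add0r /leave_one_out -/z.
  have := label_sqr z.1 (R := R); set y := label z.1 => y1.
  rewrite mulrBr !mulrA mulrBr.
  have -> : y * (tnth z.2 d * y * tnth z.2 d) = y ^+ 2 * tnth z.2 d ^+ 2.
    by ring.
  by rewrite y1; ring.
have E0 : 0 < E := expR_gt0 _.
have c0 : 0 <= c ^+ 2 := sqr_ge0 _.
have [mg|mg] := leP (4 - q - label z.1 * c) 0.
  by rewrite /ramp_loss /= marginE mg; lra.
apply: le_trans (proj1 (andP (ramp_loss01 _ _))).
rewrite subr_le0.
have [q8|q8] := ltP q 8.
  have : 1 <= E; last lra.
  rewrite -expR0 ler_expR sumrB sumr_const card_ord -mulr_sumr -/q -mulr_natr.
  have : 0 <= 3 * D%:R / 64 * (8 - q).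
    by rewrite mulr_ge0 ?subr_ge0 ?(ltW q8)// divr_ge0// mulr_ge0// ltW.
  by lra.
have : (label z.1 * c) ^+ 2 = c ^+ 2 by rewrite exprMn label_sqr mul1r.
by set w := label z.1 * c in mg *; nra.
Qed.

(** The three ways in which the gap falls short of 1: short noise vectors, large cross terms on the
    flipped data, and the risk of the learned hypothesis. *)
Definition deficit (s : m.-tuple datum) : R :=
  m%:R^-1 * anticoncentration s +
  (m%:R^-1 / 16 * cross_energy (fun=> 0) s +
   192 / D%:R / 9 * \sum_(d < D) weight s d ^+ 2).

Lemma emp_risk_flip_ge (s : m.-tuple datum) :
  1 - deficit s <=
    emp_risk loss (dataset (flip s)) (learn (dataset s)) -
    risk loss (data u) (learn (dataset s)).
Proof.
rewrite /deficit addrA opprD addrA; apply: lerB; last exact: risk_learn_le.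
rewrite /emp_risk -mulrA -mulrDr.
rewrite -[X in X - _](mulVf (lt0r_neq0 m0)) -mulrBr.
rewrite ler_wpM2l ?invr_ge0 ?(ltW m0)//.
have -> : m%:R = \sum_(i < m) 1 :> R by rewrite sumr_const card_ord.
rewrite /anticoncentration /cross_energy mulr_sumr -big_split/= -sumrB.
apply: ler_sum => i _; rewrite [16^-1 * _]mulrC !tnth_map.
exact: loss_flip_ge.
Qed.

Lemma measurable_anticoncentration : measurable_fun setT anticoncentration.
Proof.
apply: measurable_sum => i; apply: measurableT_comp => //.
apply: measurable_sum => d; apply: measurable_funB => //.
apply: measurable_funM => //; apply: measurable_funX.
exact: measurable_tuple_coord.
Qed.

Lemma measurable_sum_weight_sqr n :
  measurable_fun setT (fun s : n.-tuple datum => \sum_(d < D) weight s d ^+ 2).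
Proof.
by apply: measurable_sum => d; apply: measurable_funX; exact: measurable_weight.
Qed.

Lemma sum_weight_sqr_ge0 n (s : n.-tuple datum) :
  0 <= \sum_(d < D) weight s d ^+ 2.
Proof. by apply: sumr_ge0 => d _; exact: sqr_ge0. Qed.

Lemma anticoncentration_ge0 s : 0 <= anticoncentration s.
Proof. by apply: sumr_ge0 => i _; exact: expR_ge0. Qed.

Lemma deficit_ge0 s : 0 <= deficit s.
Proof.
rewrite /deficit addr_ge0 ?mulr_ge0 ?invr_ge0 ?anticoncentration_ge0 ?(ltW m0)//.
by rewrite addr_ge0// mulr_ge0 ?cross_energy_ge0 ?sum_weight_sqr_ge0.
Qed.

Lemma measurable_deficit : measurable_fun setT deficit.
Proof.
apply: measurable_funD.
  apply: measurable_funM => //; exact: measurable_anticoncentration.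
apply: measurable_funD; apply: measurable_funM => //.
  by apply/measurable_EFinP; exact: measurable_cross_energy.
exact: measurable_sum_weight_sqr.
Qed.

(** 6400 = 192^2 / 16 + 192^2 / 9: the first summand comes from the cross terms, the second from the
    risk. *)
Lemma integral_deficit_le :
  (\int[iid (@coin_noise R D) m]_s (deficit s)%:E <=
    ((4 / 5) ^+ D + 6400 * (m%:R / D%:R))%:E)%E.
Proof.
have Ia : (\int[iid (@coin_noise R D) m]_s (anticoncentration s)%:E <=
    (m%:R * (4 / 5) ^+ D)%:E)%E.
  apply: (@integral_iid_sum_le _ _ _ (@coin_noise R D) (fun z : datum =>
    expR (\sum_(d < D) (3 / 8 - 3 * D%:R / 64 * tnth z.2 d ^+ 2)))).
  - apply: measurableT_comp => //; apply: measurable_sum => d.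
    apply: measurable_funB => //; apply: measurable_funM => //.
    by apply: measurable_funX; exact: measurable_noise_coord.
  - by move=> z; exact: expR_ge0.
  - apply: coin_noise_le => [||y]; last exact: noise_expR_le.
    + apply/measurable_EFinP; apply: measurableT_comp => //.
      apply: measurable_sum => d; apply: measurable_funB => //.
      apply: measurable_funM => //; apply: measurable_funX.
      exact: measurable_noise_coord.
    + by move=> z; rewrite lee_fin expR_ge0.
have Ic := @integral_cross_energy_le R D D_gt0 m (fun=> 0).
have Iw : (\int[iid (@coin_noise R D) m]_s (\sum_(d < D) weight s d ^+ 2)%:E <=
    (m%:R * 192)%:E)%E.
  have := @integral_weight_sqr_le R D D_gt0 m (fun=> 0).
  rewrite big1 ?add0r => [|d _]; last by rewrite expr0n.
  by under eq_integral do under eq_bigr do rewrite add0r.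
have k1 : 0 <= m%:R^-1 :> R by rewrite invr_ge0 ltW.
have k2 : 0 <= m%:R^-1 / 16 :> R by rewrite divr_ge0.
have k3 : 0 <= 192 / D%:R / 9 :> R by rewrite !divr_ge0// ltW.
have mc : measurable_fun setT
    (fun s : m.-tuple datum => cross_energy (fun=> 0) s).
  by apply/measurable_EFinP; exact: measurable_cross_energy.
have mw := @measurable_sum_weight_sqr m.
pose w s : R := 192 / D%:R / 9 * \sum_(d < D) @weight R D m s d ^+ 2.
have w0 s : 0 <= w s by rewrite mulr_ge0 ?sum_weight_sqr_ge0.
have mW : measurable_fun setT w by exact: measurable_funM.
have IW : (\int[iid (@coin_noise R D) m]_s (w s)%:E <=
    (192 / D%:R / 9 * (m%:R * 192))%:E)%E.
  under eq_integral do rewrite /w EFinM.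
  rewrite ge0_integralZl//; last 2 first.
  - exact/measurable_EFinP.
  - by move=> s _; rewrite lee_fin sum_weight_sqr_ge0.
  by rewrite [leRHS]EFinM lee_wpmul2l.
have I2 := integral_lincomb_le mc mW (fun s => cross_energy_ge0 _ s) w0
  k2 Ic IW.
have m2 : measurable_fun setT (fun s : m.-tuple datum =>
    m%:R^-1 / 16 * cross_energy (fun=> 0) s + w s).
  by apply: measurable_funD => //; exact: measurable_funM.
have p2 (s : m.-tuple datum) :
    0 <= m%:R^-1 / 16 * cross_energy (fun=> 0) s + w s.
  by rewrite addr_ge0// mulr_ge0// cross_energy_ge0.
have I1 := integral_lincomb_le measurable_anticoncentration m2
  anticoncentration_ge0 p2 k1 Ia I2.
apply: (le_trans I1); rewrite lee_fin big1; last by move=> d _; rewrite expr0n.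
rewrite le_eqVlt; apply/orP; left; apply/eqP; field.
by rewrite !gt_eqF.
Qed.

End sign_flipped_noise.

(** * Numerical estimates and the final lower bound *)

Lemma geometric_le {R : realType} n : (4 / 5) ^+ n * (1 + n%:R / 4) <= 1 :> R.
Proof.
elim: n => [|n IH]; first by rewrite mul0r addr0 mulr1.
(* The new factor gives 4/5 (1 + (n + 1) / 4) = 1 + n / 5 <= 1 + n / 4. *)
apply: le_trans IH; rewrite exprSr -mulrA ler_wpM2l ?exprn_ge0//.
have : 0 <= n%:R :> R by [].
by rewrite -(natr1 n); lra.
Qed.

Lemma expRN32_le {R : realType} : expR (- (3 / 2)) <= 1 / 2 :> R.
Proof.
rewrite expRN div1r lef_pV2 ?posrE ?expR_gt0//.
by have := expR_ge1Dx (3 / 2 : R); lra.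
Qed.

Theorem corollaryJ1p1 (R : realType) :
  exists C : R, 0 < C /\
  forall (K D m : nat) (u : rvec R K) (gamma eps delta : R),
    (1 <= K)%N -> (1 <= D)%N -> (2 <= m)%N ->
    norm2 u = 1 / Num.sqrt m%:R ->
    0 <= gamma <= 1 ->
    0 < eps -> 0 < delta -> delta < 1 / 12 ->
    C * Num.max (m%:R * ln (3 / delta)) (m%:R * ln (1 / eps)) <= D%:R ->
    ((expR (- (3 / 2)) * (1 - eps) - (1 - expR (- (3 / 2))) * eps)%:E
      <= eps_pb_det_A
           (fun (h : hypothesis R K D) (z : sample R K D) =>
              ramp_loss gamma (output h z.1) (label z.2))
           (data u) (@learn R K D m) delta)%E.
Proof.
(* Chosen so that D >= 190 * 150 m, whence 6400 m / D < 0.23; the logarithm costs only a factor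
   35/36. *)
exists (200 * 150); split; first by rewrite mulr_gt0.
move=> K D m u gamma eps delta _ D_gt0 m_ge2 norm_u gamma01.
move=> eps_gt0 delta_gt0 delta_lt D_ge.
have m_gt0 : (0 < m)%N by exact: ltnW.
have m1 : 1 <= m%:R :> R by rewrite ler1n.
have D_m : 190 * 150 * m%:R <= D%:R :> R.
  apply: le_trans D_ge.
  have ln_ge : 35 / 36 <= ln (3 / delta).
    (* ln x <= x - 1 at x = delta / 3 < 1/36. *)
    have d3 : 0 < delta / 3 by rewrite divr_gt0.
    rewrite -[X in ln X]invf_div lnV ?posrE//.
    by have := @le_ln1Dx R (delta / 3 - 1); rewrite subrKC; lra.
  apply: (@le_trans _ _ (200 * 150 * (m%:R * ln (3 / delta)))); last first.
    by rewrite ler_wpM2l// le_max lexx.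
  by move: m1 ln_ge; set x := m%:R; set l := ln _; nra.
have D_gt0R : 0 < D%:R :> R by rewrite ltr0n.
have D_inv : m%:R / D%:R <= 1 / (190 * 150) :> R.
  by rewrite ler_pdivrMr//; lra.
have defD : (4 / 5) ^+ D + 6400 * (m%:R / D%:R) <= 1 / 4 :> R.
  have geo := @geometric_le R D.
  have pow0 : 0 <= (4 / 5) ^+ D :> R by rewrite exprn_ge0.
  have D400 : 400 <= D%:R :> R by lra.
  have : (4 / 5) ^+ D <= 1 / 100 :> R.
    by move: pow0 geo; set x := (4 / 5) ^+ D; nra.
  by move: D_inv; set y := m%:R / D%:R; lra.
apply: le_ereal_inf_tmp => v [Sd [mSd PSd [P [Q [PB sup_lt]]]]].
apply: le_trans (ltW sup_lt).
pose phi (s : m.-tuple (bool * rvec R D)) := [tuple of map (make_sample u) s].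
pose flip (s : m.-tuple (bool * rvec R D)) := [tuple of map flip_noise s].
have mphi : measurable_fun setT phi by exact: measurable_map_tuple.
have mflip : measurable_fun setT flip.
  by apply: measurable_map_tuple; exact: measurable_flip_noise.
have Iphi : image_law (iid (@coin_noise R D) m) phi (iid (data u) m).
  by apply: image_law_iid => //; exact: image_law_distribution.
have Iflip : image_law (iid (@coin_noise R D) m) flip (iid (@coin_noise R D) m).
  apply: image_law_iid; first exact: measurable_flip_noise.
  exact: image_law_flip_noise.
have mSdC : measurable (~` Sd) by exact: measurableC.
have mA : measurable (phi @^-1` ~` Sd).
  by rewrite -[X in measurable X]setTI; exact: mphi.
have mB : measurable (flip @^-1` (phi @^-1` ~` Sd)).
  by rewrite -[X in measurable X]setTI; exact: mflip.
(* The event is pulled back to pairs of label and noise, where the flip preserves the law; so both S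
   and its flip avoid [Sd] with probability at most delta. *)
have PA := PSd; rewrite (image_law_measure mphi Iphi mSdC) in PA.
have PflipA := PA; rewrite (image_law_measure mflip Iflip mA) in PflipA.
(* The budget is delta + delta + 2 * 1/4 < 1/6 + 1/2 < 1. *)
have [||s [sA sB s_def]] := exists_avoiding mA mB (@measurable_deficit R D m)
  (@deficit_ge0 R D m m_gt0) PA PflipA
  (le_trans (integral_deficit_le D_gt0 m_gt0) (_ : _ <= (1 / 4)%:E)%E).
- by rewrite lee_fin.
- by lra.
have {}sA : Sd (phi s) by exact: contrapT.
have {}sB : Sd (phi (flip s)) by exact: contrapT.
have loss01 (h : hypothesis R K D) (z : sample R K D) :=
  ramp_loss01 gamma (output h z.1) (label z.2).
have := derandomized_bound_ge loss01 (Q (learn (phi s))) (learn (phi s))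
  (PB _ sB).
move=> bound; apply: le_trans (le_trans bound _); last first.
  (* The pair at which the supremum is tested is mixed: the data set is the flipped one, the
     hypothesis is learned from the original. *)
  apply: ereal_sup_ubound; exists (phi (flip s)) => //.
  by exists (learn (phi s)) => //; exists (phi s).
rewrite lee_fin.
apply: le_trans (emp_risk_flip_ge D_gt0 m_gt0 norm_u gamma01 s).
(* The target simplifies to exp (-3/2) - eps, which is below 1/2, while [s_def] puts the gap at 1/2
   or more. *)
have := @expRN32_le R; have := expR_gt0 (- (3 / 2) : R); lra.
Qed.
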